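(* Let $h\in\mathbb{R}^{2n-1}$ be the impulse response with $h_t=1$ for all $t=1,\dots,2n-1$ (a system of order $1$), and let $\mathcal{H}:\mathbb{R}^{2n-1}\to\mathbb{R}^{n\times n}$ be the Hankel map. Consider the set $$S=\Big\{x/\|x\|_2\ :\ x\in\mathbb{R}^{2n-1}\setminus\{0\},\ \|\mathcal{H}(h+x)\|_*\le\|\mathcal{H}(h)\|_*\Big\}.$$ Then the Gaussian width of $S$ is lower bounded by $Cn^{1/6}$ for some constant $C>0$.
   Context: The Hankel map sends $x=(x_1,\dots,x_{2n-1})$ to the $n\times n$ matrix with $(j,k)$ entry $x_{j+k-1}$. $\|\cdot\|_*$ is the nuclear norm. The Gaussian width of a set $S\subset\mathbb{R}^{2n-1}$ is $w(S)=\mathbb{E}_g\sup_{\gamma\in S}\gamma^\top g$, where $g$ is a standard Gaussian vector in $\mathbb{R}^{2n-1}$.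
   Formalization: The bound is proved for all sufficiently large n, with C independent of n; it cannot hold for every n, since for n = 1 the set S is {−1} and its Gaussian width is 0. *)

(* Defs.v *)
From HB Require Import structures.
From mathcomp Require Import all_boot all_order all_algebra.
From mathcomp Require Import all_classical all_reals all_analysis.
From mathcomp Require Import zify.

Set Implicit Arguments.
Unset Strict Implicit.
Unset Printing Implicit Defensive.

Import Order.TTheory GRing.Theory Num.Theory.
Import numFieldNormedType.Exports.
Local Open Scope classical_set_scope.
Local Open Scope ring_scope.

Section Defs.
Variable R : realType.

Definition orthogonal_mx (n : nat) (U : 'M[R]_n) : Prop := U *m U^T = 1%:M.

Definition singular_values (n : nat) (A : 'M[R]_n) (s : 'rV[R]_n) : Prop :=
  (forall i, 0 <= s 0 i) /\
  exists U V : 'M[R]_n, [/\ orthogonal_mx U, orthogonal_mx V &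
                            A = U *m diag_mx s *m V^T].

Definition nuclear_norm (n : nat) (A : 'M[R]_n) : R :=
  \sum_i (xget 0 [set s | singular_values A s]) 0 i.

Lemma hankel_idx_lt (n : nat) (j k : 'I_n) : (j + k < 2 * n - 1)%N.
Proof. have := ltn_ord j; have := ltn_ord k; lia. Qed.

(* Hankel map: (j,k) entry (0-based) is x_{j+k}, i.e. 1-based x_{j+k-1}. *)
Definition hankel (n : nat) (x : 'rV[R]_(2 * n - 1)) : 'M[R]_n :=
  \matrix_(j, k) x 0 (Ordinal (hankel_idx_lt j k)).

Definition norm2 (m : nat) (x : 'rV[R]_m) : R := Num.sqrt (\sum_i x 0 i ^+ 2).

(* Expectation of f(g) for g a standard Gaussian vector in R^m,
   computed as the iterated integral against m independent N(0,1) laws.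
   Coordinates g_0, ..., g_(m-1) are the values of g : nat -> R. *)
Fixpoint gauss_expect (m : nat) (f : (nat -> R) -> \bar R) : \bar R :=
  match m with
  | 0 => f (fun _ => 0)
  | m'.+1 => (\int[normal_prob 0 1]_x
               gauss_expect m' (fun v => f (fun i => if i == 0%N then x else v i.-1)))%E
  end.

Definition gaussian_width (m : nat) (S : set 'rV[R]_m) : \bar R :=
  gauss_expect m (fun g => ereal_sup [set (\sum_i gamma 0 i * g i)%:E | gamma in S]).

Definition h_ones (n : nat) : 'rV[R]_(2 * n - 1) := const_mx 1.

Definition descent_set (n : nat) : set 'rV[R]_(2 * n - 1) :=
  [set (norm2 x)^-1 *: x | x in
     [set x | x != 0 /\
        nuclear_norm (hankel (h_ones n + x)) <= nuclear_norm (hankel (h_ones n))]].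

End Defs.

(* Main.v *)
(** Every nuclear norm is at most the sum of the absolute values of the entries,
    since it equals [tr (A Q)] for some orthogonal [Q]; and [||H(h)||_* >= tr H(h) = n].
    Let [k] be the integer part of [n^(1/3)].  Given a Gaussian vector [g], let [x]
    be [(k - 1) sign(g_i)] at the indices [i < k], and [-1] elsewhere.  Then [H(h + x)]
    has at most [k^2] nonzero entries, each at most [k] in absolute value, hence
    [||H(h + x)||_* <= k^3 <= n] and [x / ||x||_2] lies in [S].  The norm [||x||_2] is
    [O(n^(1/2))] and does not depend on [g], while
    [<x, g> = (k - 1) sum_(i < k) |g_i| - sum_(i >= k) g_i] has mean
    [k (k - 1) E|g_0|], of order [n^(2/3)]. *)

Require Import Defs.
From HB Require Import structures.
From mathcomp Require Import all_boot all_order all_algebra.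
From mathcomp Require Import all_classical all_reals all_analysis.
From mathcomp Require Import measurable_realfun ring lra zify.

Set Implicit Arguments.
Unset Strict Implicit.
Unset Printing Implicit Defensive.

Import Order.TTheory GRing.Theory Num.Theory.
Local Open Scope classical_set_scope.
Local Open Scope ring_scope.

(** * Monotonicity of the integral for arbitrary functions *)

Section integral_monotone.
Context d (T : measurableType d) (R : realType).
Variable mu : {measure set T -> \bar R}.
Local Open Scope ereal_scope.

(* Measurability is not assumed because the supremum defining the Gaussian width
   is not known to be measurable. *)
Lemma ge0_le_integralT_nomeas (f g : T -> \bar R) :
  (forall x, 0 <= f x) -> (forall x, f x <= g x) ->
  \int[mu]_x f x <= \int[mu]_x g x.
Proof.
move=> f0 fg.
rewrite !ge0_integralTE//; last by move=> x; exact: le_trans (fg x).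
apply: le_ereal_sup => _ [h /= hf <-]; exists h => //= x.
exact: le_trans (hf x) (fg x).
Qed.

Lemma le_integralT_nomeas (f g : T -> \bar R) :
  (forall x, f x <= g x) -> \int[mu]_x f x <= \int[mu]_x g x.
Proof.
move=> fg; rewrite integralE [leRHS]integralE leeB//;
  apply: ge0_le_integralT_nomeas => // x.
- by apply: funepos_le => //; rewrite inE.
- by apply: funeneg_le => //; rewrite inE.
Qed.

End integral_monotone.

(** * Iterated Gaussian expectations *)

Section gauss_expect.
Context {R : realType}.

Lemma le_gauss_expect m (f g : (nat -> R) -> \bar R) :
  (forall v, f v <= g v)%E -> (gauss_expect m f <= gauss_expect m g)%E.
Proof.
elim: m f g => [|m IH] f g fg /=; first exact: fg.
by apply: le_integralT_nomeas => x; apply: IH => v; exact: fg.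
Qed.

(** The constant [a] carries the induction: while the inner variables are integrated, the outermost
    one is fixed and its term [phi 0 x] is absorbed into the constant. *)
Lemma gauss_expect_sum m (a : R) (phi : nat -> R -> R) (e : nat -> R) :
  (forall i, (normal_prob 0 1).-integrable setT (EFin \o phi i)) ->
  (forall i, \int[normal_prob 0 1]_x (phi i x)%:E = (e i)%:E)%E ->
  gauss_expect m (fun v => (a + \sum_(i < m) phi i (v i))%:E)
  = (a + \sum_(i < m) e i)%:E.
Proof.
elim: m a phi e => [|m IH] a phi e iphi ephi /=; first by rewrite !big_ord0.
under eq_integral => x _.
  under [X in gauss_expect m X]eq_fun => v.
    rewrite big_ord_recl /= addrA.
    under eq_bigr => i _ do rewrite /bump /=.
    over.
  rewrite (IH (a + phi 0%N x) (fun i => phi i.+1) (fun i => e i.+1))//.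
  rewrite addrAC EFinD.
  over.
rewrite integralD//=.
- rewrite integral_cst// [X in (_ * X)%E]probability_setT mule1 ephi -EFinD.
  by rewrite big_ord_recl /= addrAC addrA.
- exact: finite_measure_integrable_cst.
- exact: iphi.
Qed.
End gauss_expect.

(** * First moments of the standard normal law *)

Section normal_moments.
Context {R : realType}.
Local Notation leb := (@lebesgue_measure R).
Local Notation gauss := (@normal_prob R 0 1).

(** The Radon-Nikodym derivative and [normal_pdf] have the same integral over every measurable set,
    so they agree almost everywhere. *)
Lemma ge0_integral_normal_prob (m s : R) (f : R -> \bar R) :
  measurable_fun [set: R] f -> (forall x, 0 <= f x)%E ->
  (\int[normal_prob m s]_x f x =
   \int[leb]_x (f x * (normal_pdf m s x)%:E))%E.
Proof.
move=> mf f0.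
have dom := @normal_prob_dominates R m s.
have mpdf : measurable_fun [set: R] (EFin \o normal_pdf m s).
  by apply/measurable_EFinP; exact: measurable_normal_pdf.
rewrite -(Radon_Nikodym_SigmaFinite.change_of_variables dom)//.
have ifS := Radon_Nikodym_SigmaFinite.f_integrable dom.
apply: ae_eq_integral => //.
- by apply: emeasurable_funM => //; exact: measurable_int ifS.
- exact: emeasurable_funM.
apply: ae_eqe_mul2l; apply: integral_ae_eq => //= E _ mE.
by rewrite -(Radon_Nikodym_SigmaFinite.f_integral dom).
Qed.

(* [|x| <= 1 + x^2/4 <= exp (x^2/4)] compares the integrand to the density of
   the centered normal law of variance 2. *)
Lemma integrable_gauss_id : gauss.-integrable setT (EFin \o (@id R)).
Proof.
apply/integrableP; split; first exact/measurable_EFinP.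
rewrite ge0_integral_normal_prob//; last exact/measurableT_comp/measurable_EFinP.
have s0 : Num.sqrt 2 != 0 :> R by rewrite gt_eqF// sqrtr_gt0.
have p0 : 0 < normal_peak (Num.sqrt 2 : R) by exact: normal_peak_gt0.
pose c : R := normal_peak 1 / normal_peak (Num.sqrt 2).
apply: (@le_lt_trans _ _
    (\int[leb]_x (c%:E * (normal_pdf 0 (Num.sqrt 2) x)%:E))%E); last first.
  rewrite integralZl//; last exact: integrable_normal_pdf.
  by rewrite integral_normal_pdf mule1 ltry.
apply: ge0_le_integralT_nomeas => x.
  by rewrite mule_ge0// lee_fin normal_pdf_ge0.
rewrite -!EFinM lee_fin !normal_pdfE ?oner_neq0// /c.
rewrite [leRHS]mulrA divfK ?gt_eqF// [leLHS]mulrCA.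
rewrite ler_wpM2l ?normal_peak_ge0// /normal_fun subr0 sqr_sqrtr//.
have -> : - x ^+ 2 / (2 *+ 2) = x ^+ 2 / 4 + - x ^+ 2 / (1 ^+ 2 *+ 2) by field.
rewrite expRD ler_wpM2r ?expR_ge0//.
apply: le_trans (expR_ge1Dx _).
rewrite -(real_normK (num_real x)).
have := sqr_ge0 (`|x| / 2 - 1); lra.
Qed.

Lemma integrable_gauss_norm : gauss.-integrable setT (fun x : R => `|x|%:E).
Proof. exact: (integrable_norm integrable_gauss_id). Qed.

(** The density is even and Lebesgue measure is invariant under negation. *)
Lemma gauss_opp (A : set R) : measurable A ->
  pushforward gauss (-%R : R -> measurableTypeR R) A = gauss A.
Proof.
move=> mA; rewrite /pushforward /normal_prob.
have -> : (\int[leb]_(x in -%R @^-1` A) (normal_pdf 0 1 x)%:E =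
   \int[leb]_(x in (-%R : _ -> measurableTypeR R) @^-1` A)
     ((fun x => (normal_pdf 0 1 x)%:E) \o (-%R : _ -> measurableTypeR R)) x)%E.
  apply: eq_integral => x _ /=.
  by rewrite !normal_pdfE ?oner_neq0// /normal_fun !subr0 sqrrN.
rewrite -ge0_integral_pushforward//.
- by apply: eq_measure_integral => B mB _; exact: lebesgue_measureN.
- by apply/measurable_EFinP/measurable_funTS; exact: measurable_normal_pdf.
- by move=> x _; rewrite lee_fin normal_pdf_ge0.
Qed.

(** By symmetry the mean equals its opposite; integrability makes it finite, hence zero. *)
Lemma gauss_mean0 : (\int[gauss]_x x%:E = 0)%E.
Proof.
have fin := integrable_fin_num measurableT integrable_gauss_id.
have E : (\int[gauss]_x x%:E = - \int[gauss]_x x%:E)%E.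
  rewrite -integralN/=; last exact: integrable_add_def integrable_gauss_id.
  pose opp : measurableTypeR R -> measurableTypeR R := -%R.
  have mopp : measurable_fun setT opp by exact: oppr_measurable.
  have mid : measurable_fun setT (EFin \o @id (measurableTypeR R)) by exact/measurable_EFinP.
  have iopp : gauss.-integrable (opp @^-1` setT) ((EFin \o id) \o opp).
    by rewrite preimage_setT; exact: (integrableN integrable_gauss_id).
  have := integral_pushforward mopp mid iopp measurableT.
  rewrite preimage_setT => <-.
  by apply/esym; apply: eq_measure_integral => A mA _; exact: gauss_opp.
move: fin E; case: (integral _ _ _) => //= r _ [E].
by congr EFin; lra.
Qed.

(** If the mean were 0, the identity would vanish almost everywhere, and the law would be carried by
    the Lebesgue-null set [[set 0]]. *)
Lemma gauss_norm_mean_gt0 :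
  exists2 c : R, 0 < c & (\int[gauss]_x `|x|%:E = c%:E)%E.
Proof.
have fin := integrable_fin_num measurableT integrable_gauss_norm.
exists (fine (\int[gauss]_x `|x|%:E)%E); last by rewrite fineK.
rewrite fine_gt0// -ge0_fin_numE ?fin ?andbT; last first.
  by apply: integral_ge0 => x _; rewrite lee_fin.
rewrite lt0e; apply/andP; split; last first.
  by apply: integral_ge0 => x _; rewrite lee_fin.
apply/eqP => I0.
have [] := ae_eq_integral_abs gauss measurableT (f := EFin \o @id R).
  exact/measurable_EFinP.
move=> /(_ I0) [N [mN N0 NS]] _.
suff : (gauss setT <= 0)%E.
  by rewrite probability_setT lee_fin ler10.
have g0 : gauss [set 0] = 0%E.
  have /null_content_dominatesP := @normal_prob_dominates R 0 1.
  by apply => //; exact: lebesgue_measure_set1.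
rewrite -[leRHS]adde0 -[X in (X + _)%E]N0 -[X in (_ + X)%E]g0.
apply: le_trans (measureU2 _ _ _) => //.
apply: le_measure; rewrite ?inE//; first exact: measurableU.
move=> x _; have [->|x0] := eqVneq x 0; first by right.
by left; apply: NS => /= /(_ I) [] xE; rewrite xE eqxx in x0.
Qed.
End normal_moments.

(** * Bounds on the nuclear norm *)

Section nuclear_norm.
Context {R : realType}.

Lemma orthogonal_mx_tr n (U : 'M[R]_n) : orthogonal_mx U -> orthogonal_mx U^T.
Proof. by rewrite /orthogonal_mx trmxK => /mulmx1C. Qed.

Lemma orthogonal_mxM n (U V : 'M[R]_n) :
  orthogonal_mx U -> orthogonal_mx V -> orthogonal_mx (U *m V).
Proof.
move=> oU oV.
by rewrite /orthogonal_mx trmx_mul mulmxA -(mulmxA U) oV mulmx1 oU.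
Qed.

Lemma orthogonal_mx_entry_le1 n (U : 'M[R]_n) i j :
  orthogonal_mx U -> `|U i j| <= 1.
Proof.
move=> /matrixP /(_ i i); rewrite !mxE eqxx mulr1n => E.
rewrite -(ler_pXn2r (_ : 0 < 2)%N) ?nnegrE// expr1n real_normK ?num_real//.
rewrite -E (bigD1 j)//= !mxE -expr2 lerDl.
by apply: sumr_ge0 => k _; rewrite !mxE -expr2 sqr_ge0.
Qed.

(** For [A = U D V^T] the sum is the trace of [A (V U^T)], and an orthogonal matrix has entries in
    [-1, 1]. *)
Lemma sum_singular_values_le n (A : 'M[R]_n) s : singular_values A s ->
  \sum_i s 0 i <= \sum_i \sum_j `|A i j|.
Proof.
move=> [_ [U [V [oU oV AE]]]].
have oW : orthogonal_mx (V *m U^T).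
  by apply: orthogonal_mxM => //; exact: orthogonal_mx_tr.
have -> : \sum_i s 0 i = \tr (A *m (V *m U^T)).
  have VV := orthogonal_mx_tr oV; have UU := orthogonal_mx_tr oU.
  rewrite /orthogonal_mx !trmxK in VV UU.
  rewrite AE mulmxA -(mulmxA _ V^T) VV mulmx1 -mulmxA mxtrace_mulC -mulmxA UU.
  by rewrite mulmx1 mxtrace_diag.
apply: ler_sum => i _; rewrite mxE; apply: ler_sum => j _.
apply: le_trans (ler_norm _) _; rewrite normrM ler_piMr//.
exact: orthogonal_mx_entry_le1.
Qed.

(** The trace of [A] is that of [D (V^T U)], whose diagonal entries are at most those of [D]. *)
Lemma mxtrace_le_sum_singular_values n (A : 'M[R]_n) s :
  singular_values A s -> \tr A <= \sum_i s 0 i.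
Proof.
move=> [s0 [U [V [oU oV ->]]]].
have oW : orthogonal_mx (V^T *m U).
  by apply: orthogonal_mxM => //; exact: orthogonal_mx_tr.
rewrite -mulmxA mxtrace_mulC -mulmxA; apply: ler_sum => i _.
rewrite mul_diag_mx mxE ler_piMr//.
by apply: le_trans (ler_norm _) _; exact: orthogonal_mx_entry_le1.
Qed.

(* If no singular value decomposition existed, the nuclear norm would be the
   junk value 0, which also satisfies the bound. *)
Lemma nuclear_norm_le n (A : 'M[R]_n) :
  nuclear_norm A <= \sum_i \sum_j `|A i j|.
Proof.
rewrite /nuclear_norm; case: xgetP => [s _ /= /sum_singular_values_le //|_].
under eq_bigr do rewrite mxE.
by rewrite big1//; do 2 apply: sumr_ge0 => ? _.
Qed.

(** An explicit decomposition guarantees that [xget] does not return its default value. *)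
Lemma mxtrace_le_nuclear_norm n (A : 'M[R]_n) s :
  singular_values A s -> \tr A <= nuclear_norm A.
Proof.
move=> As; apply: mxtrace_le_sum_singular_values.
exact: (xgetPex 0 (ex_intro _ s As : [set s | singular_values A s] !=set0)).
Qed.

(* The Householder reflection exchanging the first basis vector e with the unit
   vector u = (1, ..., 1) / sqrt n diagonalises n u u^T. *)
Lemma singular_values_ones n :
  singular_values (const_mx 1 : 'M[R]_n.+2)
    (\row_j if j == 0 then n.+2%:R else 0).
Proof.
split; first by move=> i; rewrite mxE; case: ifP.
pose a : R := (Num.sqrt n.+2%:R)^-1.
have a2 : a ^+ 2 * n.+2%:R = 1.
  by rewrite exprVn sqr_sqrtr ?ler0n// mulVf// pnatr_eq0.
(* Size at least 2 keeps [u] distinct from [e], so the reflection is well defined. *)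
have a1 : 1 - a != 0.
  apply/eqP => /eqP; rewrite subr_eq0 => /eqP E.
  by move: a2; rewrite -E expr1n mul1r => /eqP; rewrite pnatr_eq1.
pose u : 'cV[R]_n.+2 := const_mx a.
pose e : 'cV[R]_n.+2 := delta_mx 0 0.
have uu : u^T *m u = 1%:M.
  apply/matrixP => i j; rewrite !ord1 !mxE.
  under eq_bigr do rewrite !mxE -expr2.
  by rewrite sumr_const card_ord eqxx -mulr_natr a2.
have ee : e^T *m e = 1%:M.
  by rewrite trmx_delta mul_delta_mx; apply/matrixP => i j; rewrite !ord1 !mxE.
have ue : u^T *m e = a%:M.
  apply/matrixP => i j; rewrite !ord1 !mxE (bigD1 0)//= big1 => [|k k0].
    by rewrite !mxE eqxx mulr1 addr0.
  by rewrite !mxE (negbTE k0) mulr0.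
have eu : e^T *m u = a%:M by rewrite -[LHS]trmxK trmx_mul trmxK ue tr_scalar_mx.
pose v := u - e.
have ve : v^T *m e = (a - 1)%:M.
  by rewrite linearB mulmxBl ue ee -raddfB.
have vv : v^T *m v = (2 * (1 - a))%:M.
  rewrite mulmxBr ve linearB mulmxBl uu eu -!raddfB; congr _%:M; ring.
(* This is [1 - 2 v v^T / (v^T v)], as [v^T v = 2 (1 - a)]. *)
pose U : 'M[R]_n.+2 := 1%:M - (1 - a)^-1 *: (v *m v^T).
have UT : U^T = U by rewrite linearB linearZ /= trmx_mul trmxK trmx1.
have oU : orthogonal_mx U.
  rewrite /orthogonal_mx UT mulmxBl mul1mx mulmxBr mulmx1.
  rewrite -scalemxAl -scalemxAr -(mulmxA v) (mulmxA v^T) vv mul_scalar_mx.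
  rewrite -scalemxAr !scalerA.
  have -> : (1 - a)^-1 * ((1 - a)^-1 * (2 * (1 - a))) = (1 - a)^-1 + (1 - a)^-1.
    by field.
  by rewrite scalerDl /U opprB addrK subrK.
have Ue : U *m e = u.
  rewrite mulmxBl mul1mx -scalemxAl -mulmxA ve mul_mx_scalar scalerA.
  have -> : (1 - a)^-1 * (a - 1) = -1 by field.
  by rewrite scaleN1r opprK addrC subrK.
exists U, U; split => //.
have -> : diag_mx (\row_j if j == 0 then n.+2%:R else 0) = n.+2%:R *: (e *m e^T).
  rewrite trmx_delta mul_delta_mx; apply/matrixP => i j; rewrite !mxE.
  have [->|ij] := eqVneq i j.
    by rewrite mulr1n; case: eqP => _; rewrite ?mulr1 ?mulr0.
  rewrite mulr0n; case: eqP => [i0|]; case: eqP => [j0|]; rewrite ?mulr0//.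
  by rewrite i0 j0 eqxx in ij.
rewrite -scalemxAr -scalemxAl !mulmxA Ue -mulmxA -trmx_mul Ue.
apply/matrixP => i j; rewrite !mxE big_ord1 !mxE -expr2 mulrC.
by rewrite a2.
Qed.

Lemma hankel_ones n : hankel (@h_ones R n) = const_mx 1.
Proof. by apply/matrixP => i j; rewrite !mxE. Qed.

Lemma nuclear_norm_ones_ge n : n.+2%:R <= nuclear_norm (hankel (@h_ones R n.+2)).
Proof.
rewrite hankel_ones; apply: le_trans (mxtrace_le_nuclear_norm (singular_values_ones n)).
rewrite /mxtrace; under eq_bigr do rewrite mxE.
by rewrite sumr_const card_ord.
Qed.

End nuclear_norm.

Lemma card_ord_ltn m k : (k <= m)%N -> #|[pred i : 'I_m | (i < k)%N]| = k.
Proof. by move=> km; rewrite -sum1_card (big_ord_narrow km) sum1_card card_ord. Qed.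

(** * The descent direction adapted to a Gaussian vector *)

Section descent_direction.
Context {R : realType}.

Definition sign_perturbation (n k : nat) (g : nat -> R) : 'rV[R]_(2 * n - 1) :=
  \row_i if (i < k)%N then (k%:R - 1) * (if 0 <= g i then 1 else -1) else -1.

Lemma sign_perturbation_nuclear_norm n k g : (1 < k)%N -> (k ^ 3 <= n)%N ->
  nuclear_norm (hankel (h_ones R n + sign_perturbation n k g))
    <= nuclear_norm (hankel (h_ones R n)).
Proof.
move=> k1 kn; have k1R : 1 <= k%:R :> R by rewrite ler1n; lia.
apply: le_trans (nuclear_norm_le _) _.
apply: (@le_trans _ _ n%:R); last first.
  case: n kn => [|[|n]] kn; [nia|nia|exact: nuclear_norm_ones_ge].
(* Nonzero entries have [i + j < k], so they lie in the upper left [k] by [k] corner; they equal [k]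
   or [2 - k]. *)
apply: (@le_trans _ _
    (\sum_(i < n | (i < k)%N) \sum_(j < n | (j < k)%N) (k%:R : R))).
  rewrite [leRHS]big_mkcond/=; apply: ler_sum => i _.
  rewrite (_ : (if _ then _ else _) =
      \sum_(j < n) if ((i < k) && (j < k))%N then k%:R else 0); last first.
    by case: ifP => _ /=; [rewrite big_mkcond|rewrite big1].
  apply: ler_sum => j _; rewrite !mxE /=.
  case: (ltnP (i + j) k) => [ijk|kij].
    have -> /= : ((i < k) && (j < k))%N by lia.
    case: ifP => _; rewrite ?mulr1 ?mulrN1 ler_norml; apply/andP; split; lra.
  by rewrite subrr normr0; case: ifP.
have knn : (k <= n)%N by nia.
rewrite !sumr_const -!mulrnA ler_nat.
by rewrite card_ord_ltn//; nia.
Qed.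

(** Since the norm is free of [g], the normalised dot product remains a sum of functions of single
    coordinates, the form that [gauss_expect_sum] handles. *)
Lemma sign_perturbation_norm2 n k g : (k <= 2 * n - 1)%N ->
  norm2 (sign_perturbation n k g) =
  Num.sqrt (k%:R * (k%:R - 1) ^+ 2 + (2 * n - 1 - k)%:R).
Proof.
move=> kn; congr Num.sqrt.
rewrite (bigID (fun i : 'I__ => (i < k)%N))/=; congr (_ + _).
  rewrite (eq_bigr (fun=> (k%:R - 1) ^+ 2)) => [|i ik]; last first.
    by rewrite mxE ik; case: ifP => _; rewrite ?mulr1 ?mulrN1 ?sqrrN.
  by rewrite sumr_const card_ord_ltn// mulr_natl.
rewrite (eq_bigr (fun=> 1)) => [|i ik]; last first.
  by rewrite mxE (negbTE ik) sqrrN expr1n.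
rewrite sumr_const; congr (_%:R).
rewrite -[X in (X - k)%N]card_ord -(cardC [pred i : 'I_(2 * n - 1) | (i < k)%N]).
by rewrite card_ord_ltn// addKn.
Qed.

Lemma sign_perturbation_neq0 n k g : (1 < k)%N -> (k ^ 3 <= n)%N ->
  sign_perturbation n k g != 0.
Proof.
move=> k1 kn; have n0 : (0 < 2 * n - 1)%N by nia.
apply/eqP => /matrixP /(_ 0 (Ordinal n0)); rewrite !mxE /= ifT; last by lia.
have : 2%:R <= k%:R :> R by rewrite ler_nat.
by case: ifP => _; lra.
Qed.

Lemma sign_perturbation_dot n k g :
  \sum_i sign_perturbation n k g 0 i * g i =
  \sum_(i < 2 * n - 1) if (i < k)%N then (k%:R - 1) * `|g i| else - g i.
Proof.
apply: eq_bigr => i _; rewrite mxE; case: ifP => _; last by rewrite mulN1r.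
rewrite -mulrA; congr (_ * _).
case: ifPn => [g0|]; first by rewrite mul1r ger0_norm.
by rewrite -ltNge => g0; rewrite mulN1r ltr0_norm.
Qed.

Lemma gaussian_width_ge n k (c : R) : (1 < k)%N -> (k ^ 3 <= n)%N ->
  (\int[normal_prob 0 1]_x `|x|%:E = c%:E)%E ->
  (((Num.sqrt (k%:R * (k%:R - 1) ^+ 2 + (2 * n - 1 - k)%:R))^-1 *
    (k%:R * (k%:R - 1) * c))%:E <= gaussian_width (@descent_set R n))%E.
Proof.
move=> k1 kn cE; have kn' : (k <= 2 * n - 1)%N by nia.
set d := Num.sqrt _.
(* [phi i] is the [i]-th term of the normalised dot product and [e i] its mean. *)
pose phi (i : nat) (x : R) : R :=
  d^-1 * if (i < k)%N then (k%:R - 1) * `|x| else - x.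
pose e (i : nat) : R := d^-1 * if (i < k)%N then (k%:R - 1) * c else 0.
have intn : (normal_prob 0 1).-integrable setT (fun x : R => (- x)%:E).
  exact: (integrableN integrable_gauss_id).
have iphi i : (normal_prob 0 1).-integrable setT (EFin \o phi i).
  have intf : (normal_prob 0 1).-integrable setT
      (fun x : R => (if (i < k)%N then (k%:R - 1) * `|x| else - x)%:E).
    case: (i < k)%N => //.
    exact: (integrableZl measurableT (k%:R - 1) integrable_gauss_norm).
  exact: (integrableZl measurableT d^-1 intf).
have ephi i : (\int[normal_prob 0 1]_x (phi i x)%:E = (e i)%:E)%E.
  rewrite /phi /e; case: (i < k)%N.
    under eq_integral do rewrite mulrA EFinM.
    by rewrite integralZl//; [rewrite cE mulrA EFinM|exact: integrable_gauss_norm].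
  under eq_integral do rewrite mulrN -mulNr EFinM.
  rewrite integralZl//; last exact: integrable_gauss_id.
  by rewrite gauss_mean0 mule0 mulr0.
have -> : d^-1 * (k%:R * (k%:R - 1) * c) = 0 + \sum_(i < 2 * n - 1) e i.
  rewrite add0r -mulr_sumr; congr (_ * _).
  by rewrite -big_mkcond/= sumr_const card_ord_ltn// -[RHS]mulr_natl mulrA.
rewrite -(gauss_expect_sum _ _ iphi ephi).
apply: le_gauss_expect => g; rewrite add0r.
apply: ereal_sup_ubound => /=.
exists (d^-1 *: sign_perturbation n k g).
  exists (sign_perturbation n k g) => /=; last by rewrite sign_perturbation_norm2.
  split; first exact: sign_perturbation_neq0.
  exact: sign_perturbation_nuclear_norm.
congr EFin; under eq_bigr do rewrite mxE -mulrA.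
by rewrite -!mulr_sumr sign_perturbation_dot.
Qed.

End descent_direction.

(** * Choice of [k] and of the constants *)

Lemma cube_root_nat n : exists2 k, (k ^ 3 <= n)%N & (n < k.+1 ^ 3)%N.
Proof.
elim: n => [|n [k kn nk]]; first by exists 0%N.
case: (ltnP n.+1 (k.+1 ^ 3)) => h; last by exists k.+1 => //; nia.
by exists k => //; lia.
Qed.

Theorem theorem2 (R : realType) :
  exists C : R, 0 < C /\
    exists N : nat, forall n : nat, (N <= n)%N ->
      ((C * (n%:R `^ (6%:R^-1)))%:E <= gaussian_width (@descent_set R n))%E.
Proof.
have [c c0 cE] := @gauss_norm_mean_gt0 R.
(* With [q = n^(1/6)], 16 is the product of the factors 2, 4 and 2 in [d q <= 2 q^4], [q^4 <= 4 k^2]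
   and [k^2 <= 2 k (k - 1)]. *)
exists (c / 16); split; first by rewrite divr_gt0.
(* From 8 on, the integer cube root [k] is at least 2. *)
exists 8%N => n n8.
have [k kn nk] := cube_root_nat n.
have k1 : (1 < k)%N by nia.
apply: le_trans (gaussian_width_ge k1 kn cE); rewrite lee_fin.
set d := Num.sqrt _; set q := n%:R `^ _.
have q0 : 0 < q by apply: powR_gt0; rewrite ltr0n; lia.
have q6 : q ^+ 6 = n%:R.
  by rewrite -powR_mulrn ?powR_ge0// -powRrM mulVf ?pnatr_eq0// powRr1.
have k2R : 2 <= k%:R :> R by rewrite (ler_nat _ 2).
have kR : k%:R ^+ 3 <= q ^+ 6 by rewrite q6 -natrX ler_nat.
(* After cubing: [n < (k + 1)^3 <= (2 k)^3]. *)
have q2 : q ^+ 2 <= 2 * k%:R.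
  rewrite -(ler_pXn2r (_ : 0 < 3)%N) ?nnegrE ?sqr_ge0 ?mulr_ge0//.
  rewrite -exprM q6 -natrM -natrX ler_nat.
  by apply: leq_trans (ltnW nk) _; rewrite leq_exp2r//; lia.
have d0 : 0 < d.
  rewrite sqrtr_gt0 ltr_wpDr// mulr_gt0//; first lra.
  by rewrite exprn_gt0//; lra.
(* Here [k (k - 1)^2 <= k^3 <= n], so [d^2 <= 3 n <= 4 q^6]. *)
have dq : d <= 2 * q ^+ 3.
  rewrite -(ler_pXn2r (_ : 0 < 2)%N) ?nnegrE ?(ltW d0) ?mulr_ge0 ?exprn_ge0 ?(ltW q0)//.
  rewrite sqr_sqrtr; last by rewrite addr_ge0// mulr_ge0// sqr_ge0.
  rewrite exprMn -exprM/=.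
  have : (2 * n - 1 - k)%:R <= 2 * n%:R :> R by rewrite -natrM ler_nat; lia.
  by rewrite -q6; nra.
rewrite ler_pdivlMl//.
have dqq : d * q <= 2 * q ^+ 4.
  by rewrite (exprSr q 3) mulrA ler_wpM2r// ltW.
have q4 : q ^+ 4 <= 4 * k%:R ^+ 2.
  rewrite (exprM q 2 2) (_ : 4 * _ = (2 * k%:R) ^+ 2); last by ring.
  by rewrite ler_pXn2r ?nnegrE ?sqr_ge0 ?mulr_ge0.
have kk : k%:R ^+ 2 <= 2 * (k%:R * (k%:R - 1)) :> R by nra.
rewrite (_ : d * _ = d * q * (c / 16)); last by ring.
apply: (@le_trans _ _ (16 * (k%:R * (k%:R - 1)) * (c / 16))).
  by rewrite ler_wpM2r ?divr_ge0 ?(ltW c0)//; lra.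
by rewrite le_eqVlt; apply/orP; left; apply/eqP; field.
Qed.
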